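(* Let $(X,\mathcal{R}_\mu,\mu)$ be a probability space (with values in a complete non-Archimedean valued field $K$) and let $T:X\to X$ be an invertible measure preserving transformation. Then the operator $U_T:L^1(\mu)\to L^1(\mu)$, $f\mapsto f\circ T$, preserves the norm on $L^1(\mu)$, i.e. $\|U_Tf\|_\mu=\|f\|_\mu$ for all $f\in L^1(\mu)$.
   Context: Let $K$ be a complete non-Archimedean valued field with absolute value $|\cdot|$. For a set $X$, a covering ring is a collection $\mathcal{R}\subseteq\mathcal{P}(X)$ that covers $X$ and is closed under $A\cap B$, $A\cup B$, $A\setminus B$. It is separating if for all distinct $x,y\in X$ there is $A\in\mathcal{R}$ with $x\in A$, $y\notin A$; it is an algebra if $X\in\mathcal{R}$. All covering rings are assumed separating. The $\mathcal{R}$-topology is the topology on $X$ with basis $\mathcal{R}$. A subcollection $\mathcal{A}\subset\mathcal{R}$ is shrinking if the intersection of any two elements of $\mathcal{A}$ contains an element of $\mathcal{A}$. A measure is a map $\mu:\mathcal{R}\to K$ that is additive on disjoint sets, bounded (for every $A\in\mathcal{R}$ the set $\{\mu(B):B\in\mathcal{R},B\subset A\}$ is bounded), and continuous (if $\mathcal{A}\subset\mathcal{R}$ is shrinking with $\bigcap_{A\in\mathcal{A}}A=\emptyset$, then for every $\epsilon>0$ there is $A_0\in\mathcal{A}$ with $|\mu(A)|<\epsilon$ for every $A\in\mathcal{A}$ contained in $A_0$). Put $\|A\|_\mu=\sup\{|\mu(B)|:B\in\mathcal{R},B\subset A\}$, $N_\mu(x)=\inf\{\|U\|_\mu:U\in\mathcal{R},x\in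 U\}$, and $X_0(\mu)=\{x\in X:N_\mu(x)=0\}$. For $f:X\to K$ put $\|f\|_\mu=\sup_{x\in X}|f(x)|N_\mu(x)$. Step functions are finite $K$-linear combinations of indicator functions $\chi_A$, $A\in\mathcal{R}$; the integral is the linear functional on step functions with $\int\chi_A\,d\mu=\mu(A)$; $f$ is integrable if there are step functions $f_n$ with $\|f_n-f\|_\mu\to0$, and the integral extends by continuity. $L(\mu)$ is the space of integrable functions, and $L^1(\mu)$ is $L(\mu)$ modulo equality outside a subset of $X_0(\mu)$, with the norm induced by $\|\cdot\|_\mu$. $\mathcal{R}_\mu$ is the collection of sets $A\subset X$ with $\chi_A$ integrable; it is a covering ring containing $\mathcal{R}$ and $\mu$ extends to it by $\mu(A)=\int\chi_A\,d\mu$. The triple $(X,\mathcal{R}_\mu,\mu)$ is a probability space if $\mathcal{R}$ is an algebra and $\mu(X)=1$. A measure preserving transformation is a map $T:X\to X$ that is continuous for the $\mathcal{R}_\mu$-topology and satisfies $\mu(T^{-1}B)=\mu(B)$ for all $B\in\mathcal{R}_\mu$; it is invertible if it is a homeomorphism and $\mu(TB)=\mu(B)$ for all $B\in\mathcal{R}_\mu$. *)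

(* Defs.v *)
From HB Require Import structures.
From mathcomp Require Import all_boot all_order all_algebra.
From mathcomp Require Import generic_quotient.
From mathcomp Require Import all_classical all_reals all_analysis.
Import Order.TTheory GRing.Theory Num.Theory.
Import numFieldNormedType.Exports.

Set Implicit Arguments.
Unset Strict Implicit.
Unset Printing Implicit Defensive.

Local Open Scope classical_set_scope.
Local Open Scope ring_scope.
Local Open Scope quotient_scope.

Record completeNAField (R : realType) := CompleteNAField {
  na_field :> fieldType;
  vabs : na_field -> R;
  vabs_ge0 : forall x, 0 <= vabs x;
  vabs_eq0 : forall x, vabs x = 0 <-> x = 0;
  vabsM : forall x y, vabs (x * y) = vabs x * vabs y;
  vabsD : forall x y, vabs (x + y) <= Num.max (vabs x) (vabs y);
  vabs_complete : forall u : nat -> na_field,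
    (forall e, 0 < e -> exists n0 : nat, forall m n : nat,
       (n0 <= m)%N -> (n0 <= n)%N -> vabs (u m - u n) < e) ->
    exists l, vabs (u n - l) @[n --> \oo] --> 0
}.

Section covering_rings.
Variable X : Type.

Record covering_ring (G : set (set X)) : Prop := CoveringRing {
  covering_ring_cover : \bigcup_(A in G) A = setT;
  covering_ringI : setI_closed G;
  covering_ringU : setU_closed G;
  covering_ringD : setD_closed G
}.

Definition separating (G : set (set X)) :=
  forall x y : X, x <> y -> exists2 A, G A & A x /\ ~ A y.

Definition shrinking (G F : set (set X)) :=
  F `<=` G /\
  forall A B, F A -> F B -> exists2 C, F C & C `<=` A `&` B.

Definition ring_space (G : set (set X)) : Type := X.

HB.instance Definition _ G := gen_eqMixin (ring_space G).
HB.instance Definition _ G := gen_choiceMixin (ring_space G).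
(* A covering ring covers X and is closed under intersection, so the subbase G
   is a basis of the topology it generates: see ring_space_open. *)
HB.instance Definition _ G :=
  @isSubBaseTopological.Build (ring_space G) (set X) G id.

Lemma ring_space_open (G : set (set X)) (U : set (ring_space G)) :
  covering_ring G ->
  open U <-> forall x, U x -> exists2 A, G A & A x /\ A `<=` U.
Proof.
move=> [cover GI _ _].
have fin_meet (x : X) (s : seq (set X)) :
    (forall B, B \in s -> G B) -> (forall B, B \in s -> B x) ->
    exists2 A, G A & A x /\ forall B, B \in s -> A `<=` B.
  elim: s => [_ _|B s ih sG sx].
    have [A GA Ax] : (\bigcup_(A in G) A) x by rewrite cover.
    by exists A.
  have [||A GA [Ax As]] := ih.
  - by move=> C Cs; apply: sG; rewrite inE Cs orbT.
  - by move=> C Cs; apply: sx; rewrite inE Cs orbT.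
  exists (A `&` B); first by apply: GI => //; apply: sG; rewrite inE eqxx.
  split=> [|C]; first by split=> //; apply: sx; rewrite inE eqxx.
  by rewrite inE => /predU1P[-> y []//|/As AC y [/AC]].
split=> [[D sD <-] x [V DV Vx]|h].
  have [F sF FE] := sD _ DV.
  have [||A GA [Ax AF]] := fin_meet x (finmap.enum_fset F).
  - by move=> B /sF; rewrite inE.
  - by move: Vx; rewrite -FE => + B BF => /(_ B BF).
  exists A => //; split=> // y Ay; exists V => //; rewrite -FE /= => B BF.
  exact: AF BF _ Ay.
rewrite openE => x /h[A GA [Ax AU]]; apply: filterS AU _.
apply: open_nbhs_nbhs; split=> //; exists [set A]; last by rewrite bigcup_set1.
move=> _ ->; exists (finmap.fset1 A); last by rewrite set_fset1 bigcap_set1.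
by move=> B /finmap.fset1P ->; rewrite inE.
Qed.

Definition homeomorphism (G : set (set X)) (T : X -> X) :=
  continuous (T : ring_space G -> ring_space G) /\
  exists S : X -> X, [/\ cancel T S, cancel S T
    & continuous (S : ring_space G -> ring_space G)].

End covering_rings.

Section integration.
Context {R : realType} {K : completeNAField R} {X : Type}.
Variables (G : set (set X)) (mu : set X -> K).

(* Only the values of mu on G matter. *)
Record na_measure : Prop := NAMeasure {
  na_measure_additive : forall A B, G A -> G B -> A `&` B = set0 ->
    mu (A `|` B) = mu A + mu B;
  na_measure_bounded : forall A, G A ->
    exists M : R, forall B, G B -> B `<=` A -> vabs (mu B) <= M;
  na_measure_continuous : forall F, shrinking G F ->
    \bigcap_(A in F) A = set0 ->
    forall e : R, 0 < e ->
      exists2 A0, F A0 & forall A, F A -> A `<=` A0 -> vabs (mu A) < e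
}.

(* For a measure on a covering ring, the sets in set_norm and point_norm are
   nonempty and bounded, so sup and inf in R are the true ones; fun_norm can be
   infinite, hence is valued in \bar R. *)
Definition set_norm (A : set X) : R :=
  sup [set vabs (mu B) | B in [set B | G B /\ B `<=` A]].

Definition point_norm (x : X) : R :=
  inf [set set_norm U | U in [set U | G U /\ U x]].

Definition null_points : set X := [set x | point_norm x = 0].

Definition fun_norm (f : X -> K) : \bar R :=
  ereal_sup [set (vabs (f x) * point_norm x)%:E | x in [set: X]].

(* s represents the step function \sum_((c, A) <- s) c * \1_A *)
Definition step_data (s : seq (K * set X)) := {in s, forall p, G p.2}.

Definition step_fun (s : seq (K * set X)) (x : X) : K :=
  \sum_(p <- s) p.1 * \1_(p.2) x.

Definition step_integral (s : seq (K * set X)) : K :=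
  \sum_(p <- s) p.1 * mu p.2.

Definition step_approx (s : nat -> seq (K * set X)) (f : X -> K) :=
  (forall n, step_data (s n)) /\
  fun_norm (fun x => step_fun (s n) x - f x) @[n --> \oo] --> 0%E.

Definition na_integrable (f : X -> K) := exists s, step_approx s f.

Definition has_integral (f : X -> K) (v : K) :=
  exists2 s, step_approx s f &
    vabs (step_integral (s n) - v) @[n --> \oo] --> 0.

(* The limit in has_integral exists and is unique when f is integrable. *)
Definition na_integral (f : X -> K) : K := xget 0 (has_integral f).

Definition ring_ext : set (set X) :=
  [set A | na_integrable (\1_A : X -> K)].

Definition measure_ext (A : set X) : K := na_integral (\1_A).

Definition Lfun := {f : X -> K | `[< na_integrable f >]}.

HB.instance Definition _ := Choice.on Lfun.

Definition Lfun_fun (f : Lfun) : X -> K := val f.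
Coercion Lfun_fun : Lfun >-> Funclass.

Definition eq_off_null : rel Lfun :=
  fun f g => `[< [set x | f x <> g x] `<=` null_points >].

Let eq_off_null_refl : reflexive eq_off_null.
Proof. by move=> f; apply/asboolP => x /=. Qed.

Let eq_off_null_sym : symmetric eq_off_null.
Proof.
by move=> f g; apply/asboolP/asboolP => h x /= /nesym; exact: h.
Qed.

Let eq_off_null_trans : transitive eq_off_null.
Proof.
move=> g f h /asboolP fg /asboolP gh; apply/asboolP => x /= fhx.
have [fgx|/fg//] := pselect (f x = g x).
by apply: gh => /= ghx; apply: fhx; rewrite fgx.
Qed.

Canonical eq_off_null_equiv :=
  EquivRel eq_off_null eq_off_null_refl eq_off_null_sym eq_off_null_trans.

Definition L1 : Type := {eq_quot eq_off_null}.
HB.instance Definition _ := Choice.on L1.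
HB.instance Definition _ := EqQuotient.on L1.

Definition L1_class (f : Lfun) : L1 := \pi f.

Definition L1_norm (phi : L1) : \bar R := fun_norm (repr phi).

Lemma L1_norm_class (f : Lfun) : L1_norm (L1_class f) = fun_norm f.
Proof.
have /eqmodP/asboolP h : \pi_L1 (repr (L1_class f)) = \pi f by rewrite reprK.
rewrite /L1_norm /fun_norm; congr ereal_sup; apply: eq_imagel => x _.
have [->//|/h /= N0] := pselect (Lfun_fun (repr (L1_class f)) x = f x).
by rewrite N0 !mulr0.
Qed.

Definition na_probability := [/\ na_measure, G setT & mu setT = 1].

(* T @^-1` B and T @` B are not assumed to lie in ring_ext: on a probability
   space this follows from the topological hypotheses on T. *)
Definition measure_preserving (T : X -> X) :=
  continuous (T : ring_space ring_ext -> ring_space ring_ext) /\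
  forall B, ring_ext B -> measure_ext (T @^-1` B) = measure_ext B.

Definition invertible_measure_preserving (T : X -> X) :=
  [/\ measure_preserving T, homeomorphism ring_ext T
    & forall B, ring_ext B -> measure_ext (T @` B) = measure_ext B].

(* U maps the class of each integrable f to that of f \o T, which must itself
   be integrable. This determines U. *)
Definition composition_operator (T : X -> X) (U : L1 -> L1) :=
  forall f : Lfun, exists2 g : Lfun, (g : X -> K) = f \o T
    & U (L1_class f) = L1_class g.

End integration.
Arguments Lfun {R K X} G mu.
Arguments L1 {R K X} G mu.

(* Main.v *)
(* Write N for point_norm. Continuity of mu makes the level sets {N >= e}, e > 0,
   compact, and gives set_norm A = sup of N over A. A set lies in ring_ext iff
   on each level set it coincides with a member of G; hence the two topologies
   agree on level sets, and by compactness every clopen set of the extended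
   topology lies in ring_ext. So T and its inverse preserve ring_ext, and as
   they preserve the extended measure they preserve N. The norm of f involves
   only |f| and N. *)

Require Import Defs.
From mathcomp Require Import all_boot all_order all_algebra.
From mathcomp Require Import all_classical all_reals all_analysis.
Import Order.TTheory GRing.Theory Num.Theory.
Import numFieldNormedType.Exports.

Set Implicit Arguments.
Unset Strict Implicit.
Unset Printing Implicit Defensive.

Local Open Scope classical_set_scope.
Local Open Scope ring_scope.

(** * Non-Archimedean absolute value *)

Section absolute_value.
Context {R : realType} {K : completeNAField R}.
Implicit Types x y : K.

Lemma vabs0 : vabs (0 : K) = 0.
Proof. exact/vabs_eq0. Qed.

Lemma vabs1 : vabs (1 : K) = 1.
Proof.
have n0 : vabs (1 : K) != 0 by apply/eqP => /vabs_eq0/eqP; rewrite oner_eq0.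
by apply: (mulfI n0); rewrite -vabsM !mulr1.
Qed.

Lemma vabsN x : vabs (- x) = vabs x.
Proof.
have N1 : vabs (-1 : K) = 1.
  apply/eqP; rewrite -(@eqrXn2 _ 2) ?vabs_ge0 //.
  by rewrite expr2 -vabsM mulrNN mulr1 vabs1 expr1n.
by rewrite -mulN1r vabsM N1 mul1r.
Qed.

Lemma vabs_addle x y (r : R) : vabs x <= r -> vabs y <= r -> vabs (x + y) <= r.
Proof. by move=> xr yr; rewrite (le_trans (vabsD x y)) // ge_max xr. Qed.

Lemma vabs_suble x y (r : R) : vabs x <= r -> vabs y <= r -> vabs (x - y) <= r.
Proof. by move=> xr yr; apply: vabs_addle => //; rewrite vabsN. Qed.

Lemma vabs_addlt x y (r : R) : vabs x < r -> vabs y < r -> vabs (x + y) < r.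
Proof. by move=> xr yr; rewrite (le_lt_trans (vabsD x y)) // gt_max xr. Qed.

Lemma vabs_distC x y : vabs (x - y) = vabs (y - x).
Proof. by rewrite -opprB vabsN. Qed.

End absolute_value.

(** * Algebras of sets and step functions *)

Section set_algebra.
Context {X : Type} {G : set (set X)}.
Hypotheses (ringG : covering_ring G) (GT : G setT).

Lemma algebraC A : G A -> G (~` A).
Proof. by move=> GA; rewrite -setTD; apply: (covering_ringD ringG). Qed.

Lemma algebra0 : G set0.
Proof. by rewrite -(setDv setT); apply: (covering_ringD ringG). Qed.

(** By induction on the list: on [A] the head adds [c], off [A] it adds nothing. [P] stays arbitrary
    because the induction shifts it by [c]. *)
Lemma step_fun_level {R : realType} {K : completeNAField R}
    (s : seq (K * set X)) (P : K -> Prop) :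
  step_data G s -> G [set x | P (step_fun s x)].
Proof.
elim: s P => [|[c A] s ih] P sG.
  have [P0|nP0] := pselect (P 0).
    rewrite (_ : [set _ | _] = setT) //.
    by apply/seteqP; split=> x //= _; rewrite /step_fun big_nil.
  rewrite (_ : [set _ | _] = set0); first exact: algebra0.
  by apply/seteqP; split=> x //=; rewrite /step_fun big_nil.
have GA : G A by apply: (sG (c, A)); rewrite inE eqxx.
have sG' : step_data G s by move=> p ps; apply: sG; rewrite inE ps orbT.
rewrite (_ : [set _ | _] = (A `&` [set x | P (c + step_fun s x)]) `|`
                           (~` A `&` [set x | P (step_fun s x)])).
  apply: (covering_ringU ringG); apply: (covering_ringI ringG) => //.
  - exact: (ih (fun y => P (c + y))).
  - exact: algebraC.
  - exact: ih.
apply/seteqP; split=> x /=; rewrite /step_fun big_cons /= indicE.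
  have [xA|xA] := pselect (A x).
    by rewrite mem_set // mulr1; left.
  by rewrite memNset // mulr0 add0r; right.
by case=> -[xA]; rewrite ?(mem_set xA) ?(memNset xA) ?mulr1 // mulr0 add0r.
Qed.

End set_algebra.

Section measure.
Context {R : realType} {K : completeNAField R} {X : Type}.
Context {G : set (set X)} {mu : set X -> K}.
Hypotheses (ringG : covering_ring G) (muP : na_probability G mu).

Let GT : G setT. Proof. by case: muP. Qed.
Let mu_measure : na_measure G mu. Proof. by case: muP. Qed.
Let GI := covering_ringI ringG.
Let GU := covering_ringU ringG.
Let GD := covering_ringD ringG.
Let G0 := algebra0 ringG GT.
Let GC := algebraC ringG GT.

Local Notation norm := (set_norm G mu).
Local Notation N := (point_norm G mu).

(** * Norms of sets and of points *)

Lemma na_measureU A B : G A -> G B -> A `&` B = set0 ->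
  mu (A `|` B) = mu A + mu B.
Proof. exact: na_measure_additive. Qed.

Lemma measure_split A B : G A -> G B -> mu A = mu (A `&` B) + mu (A `\` B).
Proof.
move=> GA GB; rewrite -na_measureU; [by rewrite setUIDK| exact: GI| exact: GD|].
by rewrite setDE setIACA setICr setI0.
Qed.

Lemma na_measure0 : mu set0 = 0.
Proof.
have := na_measureU G0 G0 (setI0 set0); rewrite setU0 => h.
by apply: (addrI (mu set0)); rewrite addr0 -h.
Qed.

(** An empty space would give [mu setT = 0]. A point of [X] keeps the supremum in [fun_norm] from
    being [-oo]. *)
Lemma measure_inhabited : exists x : X, True.
Proof.
apply: contrapT => nX.
have T0 : [set: X] = set0 by apply/seteqP; split=> x // _; apply: nX; exists x.
have : mu setT = 1 by case: muP.
by rewrite T0 na_measure0 => /eqP; rewrite eq_sym oner_eq0.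
Qed.

Lemma le_set_norm A B : G A -> G B -> B `<=` A -> vabs (mu B) <= norm A.
Proof.
move=> GA GB BA; apply: ub_le_sup; last by exists B.
have [M hM] := na_measure_bounded mu_measure GA.
by exists M => _ [C [GC' CA] <-]; exact: hM.
Qed.

Lemma set_norm_le A r : G A ->
  (forall B, G B -> B `<=` A -> vabs (mu B) <= r) -> norm A <= r.
Proof.
move=> GA h; apply: ge_sup.
  by exists (vabs (mu A)); exists A => //; split=> // x.
by move=> _ [C [GC' CA] <-]; exact: h.
Qed.

Lemma set_norm_ge0 A : G A -> 0 <= norm A.
Proof.
move=> GA; apply: le_trans (vabs_ge0 _) (le_set_norm GA GA _).
exact: subset_refl.
Qed.

Lemma set_norm_mono A B : G A -> G B -> A `<=` B -> norm A <= norm B.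
Proof.
move=> GA GB AB; apply: set_norm_le => // C GC' CA.
by apply: le_set_norm => // x /CA/AB.
Qed.

(** A set inside the union is cut along [A] into a piece inside [A] and a piece inside [B]; the
    ultrametric inequality bounds its measure by a maximum, not a sum. *)
Lemma set_normU A B r : G A -> G B -> norm A <= r -> norm B <= r ->
  norm (A `|` B) <= r.
Proof.
move=> GA GB Ar Br; apply: set_norm_le; first exact: GU.
move=> C GC' CAB; rewrite (measure_split GC' GA); apply: vabs_addle.
  by apply: le_trans Ar; apply: le_set_norm => //; exact: GI.
apply: le_trans Br; apply: le_set_norm => //; first exact: GD.
by move=> x [/CAB[]].
Qed.

Let lb_point_norm x : lbound [set norm U | U in [set U | G U /\ U x]] 0.
Proof. by move=> _ [U [GU' _] <-]; exact: set_norm_ge0. Qed.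

Let point_norm_nonempty x : [set norm U | U in [set U | G U /\ U x]] !=set0.
Proof. by exists (norm setT), setT. Qed.

Lemma point_norm_ge0 x : 0 <= N x.
Proof. exact: lb_le_inf. Qed.

Lemma point_norm_le U x : G U -> U x -> N x <= norm U.
Proof. by move=> GU' Ux; apply: ge_inf; [exists 0|exists U]. Qed.

Lemma point_norm_lt x r : N x < r -> exists U, [/\ G U, U x & norm U < r].
Proof.
by move=> /(inf_lt (point_norm_nonempty x))[_ [U [GU' Ux] <-] Ur]; exists U.
Qed.

(** * Continuity of the measure and compactness of level sets *)

(* Continuity is applied twice: to the sets caught between two members of F,
   and to the traces of F on a fixed set C. For E in F, the first controls mu (C `\` E)
   through C `|` E, the second mu (C `&` E). *)
Lemma shrinking_set_norm F e : shrinking G F -> \bigcap_(A in F) A = set0 ->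
  0 < e -> exists2 A, F A & norm A <= e.
Proof.
move=> [FG Fsh] F0 e0.
pose F1 := [set B | G B /\ exists A A', [/\ F A, F A', A' `<=` B & B `<=` A]].
have F1sh : shrinking G F1.
  split=> [B []//|B C [GB [A [A' [_ FA' A'B _]]]] [GC' [D [D' [_ FD' D'C _]]]]].
  have [E FE EAD] := Fsh _ _ FA' FD'.
  exists E.
    by split; [exact: FG|exists E, E; split=> // x].
  by move=> x /EAD[/A'B ? /D'C].
have FF1 : F `<=` F1 by move=> A FA; split; [exact: FG|exists A, A; split=> // x].
have F10 : \bigcap_(A in F1) A = set0.
  by apply/seteqP; split=> // x h; rewrite -F0 => A /FF1; exact: h.
have [B0 [GB0 [A [A' [FA FA' A'B0 B0A]]]] hB0] :=
  na_measure_continuous mu_measure F1sh F10 e0.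
exists A' => //; apply: set_norm_le; first exact: FG.
move=> C GC' CA'.
pose F2 := [set C `&` D | D in F].
have F2sh : shrinking G F2.
  split=> [_ [D /FG GD' <-]|_ _ [D FD <-] [E FE <-]]; first exact: GI.
  have [H FH HDE] := Fsh _ _ FD FE.
  by exists (C `&` H); [exists H|move=> x [Cx /HDE[]]].
have F20 : \bigcap_(A in F2) A = set0.
  apply/seteqP; split=> // x h; rewrite -F0 => D FD.
  by have [] : (C `&` D) x by apply: h; exists D.
have [_ [D FD <-] hD] := na_measure_continuous mu_measure F2sh F20 e0.
(* [E] lies below both [A'] and [D], so both smallness statements apply to it. *)
have [E FE EAD] := Fsh _ _ FA' FD.
have GE := FG _ FE.
have smallE : vabs (mu (C `&` E)) < e.
  by apply: hD; [exists E|move=> x [Cx /EAD[]]].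
have F1E B : G B -> E `<=` B -> B `<=` A' -> vabs (mu B) < e.
  move=> GB EB BA'; apply: hB0; last by move=> x /BA'/A'B0.
  by split=> //; exists A', E.
have EA' : E `<=` A' by move=> x /EAD[].
apply: ltW; rewrite (measure_split GC' GE); apply: vabs_addlt => //.
have -> : mu (C `\` E) = mu (C `|` E) - mu E.
  rewrite (measure_split (GU GC' GE) GE) setUC setUK setDUl setDv set0U.
  by rewrite addrC addKr.
apply: vabs_addlt; last by rewrite vabsN; exact: F1E.
by apply: F1E; [exact: GU|move=> x; right|move=> x [/CA'|/EA']].
Qed.

(* This is the compactness of the part of A where N is at least e. *)
Lemma cover_set_norm A (F : set (set X)) e :
  G A -> F `<=` G -> F !=set0 -> setU_closed F -> 0 < e ->
  (forall x, A x -> e <= N x -> exists2 U, F U & U x) ->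
  exists2 U, F U & norm (A `\` U) < e.
Proof.
move=> GA FG [U0 FU0] FU e0 hF.
have ltU V W : G V -> G W -> norm V < e -> norm W < e -> norm (V `|` W) < e.
  move=> GV GW Ve We; apply: (@le_lt_trans _ _ (Num.max (norm V) (norm W))).
    by apply: set_normU => //; rewrite le_max lexx ?orbT.
  by rewrite gt_max Ve.
(* Remainders of [A] after removing a member of the cover and a set of norm below [e]. Their
   intersection is empty: the cover removes the points with [N x >= e], small neighbourhoods remove
   the others. *)
pose H := [set B | exists U V,
  [/\ F U, G V, norm V < e & B = A `\` (U `|` V)]].
have normH0 : norm set0 < e.
  apply: le_lt_trans e0; apply: set_norm_le => // B _.
  by rewrite subset0 => ->; rewrite na_measure0 vabs0.
have Hsh : shrinking G H.
  split=> [_ [U [V [FV GV _ ->]]]|]; first by apply: GD => //; apply/GU/GV/FG.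
  move=> _ _ [U [V [FV GV Ve ->]]] [U' [V' [FV' GV' Ve' ->]]].
  exists (A `\` ((U `|` U') `|` (V `|` V'))).
    exists (U `|` U'), (V `|` V').
    by split=> //; [exact: FU|exact: GU|exact: ltU].
  by rewrite -setDUr setUACA.
have H0 : \bigcap_(B in H) B = set0.
  apply/seteqP; split=> // x hx.
  have HA V : G V -> norm V < e -> H (A `\` (U0 `|` V)) by move=> *; exists U0, V.
  have [Ax _] := hx _ (HA _ G0 normH0).
  have [eN|/point_norm_lt[V [GV Vx Ve]]] := leP e (N x).
    have [U FU' Ux] := hF x Ax eN.
    have [|_] := hx (A `\` (U `|` set0)); first by exists U, set0.
    by apply; left.
  by have [_] := hx _ (HA _ GV Ve); apply; right.
(* Halving turns the weak bound of [shrinking_set_norm] into a strict one. *)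
have e20 : 0 < e / 2 by rewrite divr_gt0.
have [_ [U [V [FU' GV Ve ->]]] small] := shrinking_set_norm Hsh H0 e20.
exists U => //; have GU' := FG _ FU'.
apply: (@le_lt_trans _ _ (norm ((A `\` (U `|` V)) `|` V))).
  apply: set_norm_mono; [exact: GD|by apply: GU => //; apply/GD/GU|].
  move=> x [Ax nUx]; have [Vx|nVx] := pselect (V x); first by right.
  by left; split=> // -[].
apply: ltU => //; first by apply/GD/GU.
by apply: le_lt_trans small _; rewrite ltr_pdivrMr // ltr_pMr // ltr1n.
Qed.

(** For every [e > 0], [A] has no point with [N x >= r + e], so the empty set alone covers that
    level and [norm A < r + e]. *)
Lemma set_norm_le_sup A r : G A -> 0 <= r -> (forall x, A x -> N x <= r) ->
  norm A <= r.
Proof.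
move=> GA r0 hN; apply/ler_addgt0Pr => e e0.
have re0 : 0 < r + e by rewrite ltr_wpDl.
have [||||_ ->] := @cover_set_norm A [set set0] (r + e) GA _ _ _ re0.
- by move=> _ ->.
- by exists set0.
- by move=> _ _ -> ->; rewrite /= setU0.
- by move=> x /hN Nr; rewrite leNgt (le_lt_trans Nr) // ltrDl.
by rewrite setD0 => /ltW.
Qed.

Lemma vabs_measure_le A r : G A -> 0 <= r -> (forall x, A x -> N x <= r) ->
  vabs (mu A) <= r.
Proof.
by move=> GA r0 /set_norm_le_sup h; apply: le_trans (h GA r0); exact: le_set_norm.
Qed.

(** * The integral is bounded by the norm on step functions *)

Lemma vabs_step_integral_le s r : step_data G s -> 0 <= r ->
  (forall x, vabs (step_fun s x) * N x <= r) -> vabs (step_integral mu s) <= r.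
Proof.
move=> sG r0 hs.
(* The listed sets may overlap, so the induction cuts [A] along each of them in turn; [c]
   accumulates the coefficients of the sets already known to contain the current piece. *)
suff h : forall A c, G A ->
    (forall x, A x -> vabs (c + step_fun s x) * N x <= r) ->
    vabs (c * mu A + \sum_(p <- s) p.1 * mu (p.2 `&` A)) <= r.
  have := h setT 0 GT; rewrite mul0r add0r.
  under eq_bigr do rewrite setIT.
  by apply=> x _; rewrite add0r.
move: sG {hs}; elim: s => [|[d B] s ih] sG A c GA hA.
  rewrite big_nil addr0 vabsM; have [->|c0] := eqVneq c 0.
    by rewrite vabs0 mul0r.
  have vc0 : 0 < vabs c.
    rewrite lt_neqAle vabs_ge0 andbT eq_sym.
    by apply/eqP => /vabs_eq0/eqP; exact/negP.
  rewrite mulrC -ler_pdivlMr //; apply: vabs_measure_le => //.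
    by rewrite divr_ge0 // ltW.
  move=> x /hA; rewrite /step_fun big_nil addr0 => h.
  by rewrite ler_pdivlMr // mulrC.
have GB : G B by apply: (sG (d, B)); rewrite inE eqxx.
have sG' : step_data G s by move=> p ps; apply: sG; rewrite inE ps orbT.
have -> : c * mu A + \sum_(p <- (d, B) :: s) p.1 * mu (p.2 `&` A) =
    ((c + d) * mu (A `&` B) + \sum_(p <- s) p.1 * mu (p.2 `&` (A `&` B))) +
    (c * mu (A `\` B) + \sum_(p <- s) p.1 * mu (p.2 `&` (A `\` B))).
  rewrite big_cons /= addrACA -big_split /= (measure_split GA GB) mulrDr mulrDl.
  rewrite (setIC B A) -!addrA; congr (_ + _); rewrite addrCA; congr (_ + (_ + _)).
  apply: eq_big_seq => p ps; rewrite -mulrDr.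
  by rewrite (measure_split (GI (sG' _ ps) GA) GB) setIA setIDA.
apply: vabs_addle; apply: ih => //; [exact: GI| |exact: GD|] => x [/hA].
  by rewrite /step_fun big_cons /= indicE => + xB; rewrite mem_set // mulr1 addrA.
by rewrite /step_fun big_cons /= indicE => + xB; rewrite memNset // mulr0 add0r.
Qed.

(** * Integrable functions *)

Lemma fun_norm_leP f r :
  (fun_norm G mu f <= r%:E)%E <-> forall x, vabs (f x) * N x <= r.
Proof.
split=> [h x|h].
  by rewrite -lee_fin (le_trans _ h) //; apply: ereal_sup_ubound; exists x.
by apply: ge_ereal_sup => _ [x _ <-]; rewrite lee_fin.
Qed.

Lemma fun_norm_ge0 f : (0 <= fun_norm G mu f)%E.
Proof.
have [x _] := measure_inhabited.
apply: (@le_trans _ _ (vabs (f x) * N x)%:E).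
  by rewrite lee_fin mulr_ge0 ?vabs_ge0 ?point_norm_ge0.
by apply: ereal_sup_ubound; exists x.
Qed.

Lemma vabs_add_point_norm (c d : K) x r :
  vabs c * N x <= r -> vabs d * N x <= r -> vabs (c + d) * N x <= r.
Proof.
move=> cr dr; apply: (@le_trans _ _ (Num.max (vabs c) (vabs d) * N x)).
  by rewrite ler_wpM2r ?point_norm_ge0 // vabsD.
by rewrite maxr_pMl ?point_norm_ge0 // ge_max cr.
Qed.

Lemma step_approx_near s f e : step_approx G mu s f -> 0 < e ->
  \forall n \near \oo, forall x, vabs (step_fun (s n) x - f x) * N x <= e.
Proof.
move=> [_ sf] e0; near=> n; apply/fun_norm_leP/ltW; near: n.
apply: (sf [set y | (y < e%:E)%E]).
exact: (@nbhs_open_ereal_lt _ _ (fun=> e)).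
Unshelve. all: by end_near. Qed.

(** Replaces the approximating sequence by one step function for each tolerance; conversely the
    tolerances [1 / (n + 1)] yield a sequence. *)
Lemma na_integrableP f : na_integrable G mu f <-> forall e, 0 < e ->
  exists2 s, step_data G s & forall x, vabs (step_fun s x - f x) * N x <= e.
Proof.
split=> [[s sf] e e0|h].
  have [n _ hn] := step_approx_near sf e0.
  by exists (s n); [exact: (proj1 sf)|exact: (hn n (leqnn n))].
have /choice[s hs] : forall n, exists s, step_data G s /\
    forall x, vabs (step_fun s x - f x) * N x <= n.+1%:R^-1.
  move=> n; have [|s sG hs] := h n.+1%:R^-1; last by exists s.
  by rewrite invr_gt0.
exists s; split=> [n|]; first exact: (proj1 (hs n)).
apply: (@squeeze_cvge _ _ _ _ (fun=> 0%E) _ (fun n => n.+1%:R^-1%:E)).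
- apply: nearW => n; rewrite fun_norm_ge0 /=; apply/fun_norm_leP.
  exact: (proj2 (hs n)).
- exact: cvg_cst.
- by apply: cvg_EFin; [exact: nearW|exact: cvg_harmonic].
Qed.

Lemma na_integrableD f g : na_integrable G mu f -> na_integrable G mu g ->
  na_integrable G mu (fun x => f x + g x).
Proof.
move=> /na_integrableP hf /na_integrableP hg; apply/na_integrableP => e e0.
have [s sG hs] := hf e e0; have [t tG ht] := hg e e0.
exists (s ++ t) => [p|x]; first by rewrite mem_cat => /orP[/sG|/tG].
rewrite /step_fun big_cat /= opprD addrACA.
exact: vabs_add_point_norm (hs x) (ht x).
Qed.

Lemma na_integrableZ c f : na_integrable G mu f ->
  na_integrable G mu (fun x => c * f x).
Proof.
move=> /na_integrableP hf; apply/na_integrableP => e e0.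
(* Adding 1 keeps the divisor positive when [c = 0]. *)
have c0 : 0 < vabs c + 1 by rewrite ltr_wpDl ?vabs_ge0.
have [|s sG hs] := hf (e / (vabs c + 1)); first by rewrite divr_gt0.
exists [seq (c * p.1, p.2) | p <- s] => [_ /mapP[p /sG Gp ->] //|x].
rewrite /step_fun big_map /=; under eq_bigr do rewrite -mulrA.
rewrite -mulr_sumr -mulrBr vabsM -mulrA.
apply: (@le_trans _ _ (vabs c * (e / (vabs c + 1)))).
  by rewrite ler_wpM2l ?vabs_ge0 // hs.
by rewrite mulrCA ler_piMr ?(ltW e0) // ler_pdivrMr // mul1r lerDl.
Qed.

(** * The extended ring and the extended measure *)

Definition level_eq (e : R) (A B : set X) :=
  forall x, e <= N x -> (A x <-> B x).

(** Off the level set the indicators differ by at most 1 in absolute value, while [N x < e]. *)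
Lemma vabs_indicB A B e x : 0 < e -> level_eq e A B ->
  vabs (\1_A x - \1_B x : K) * N x <= e.
Proof.
move=> e0 AB; rewrite !indicE; have [/AB ABx|Ne] := leP e (N x).
  have -> : (x \in A) = (x \in B) by apply/idP/idP; rewrite !inE => /ABx.
  by rewrite subrr vabs0 mul0r ltW.
apply: le_trans (ltW Ne); rewrite ler_piMl ?point_norm_ge0 //.
by apply: vabs_suble; case: (_ \in _); rewrite ?vabs0 ?vabs1.
Qed.

Lemma ring_extP A : ring_ext G mu A <->
  forall e, 0 < e -> exists2 B, G B & level_eq e A B.
Proof.
split=> [/na_integrableP h e e0|h].
  (* Where [N x >= e], a weighted error of at most [e / 2] forces an unweighted error below 1. *)
  have [|s sG hs] := h (e / 2); first by rewrite divr_gt0.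
  have s1 x : e <= N x -> vabs (step_fun s x - \1_A x) < 1.
    move=> eN; rewrite -(@ltr_pM2r _ (N x)) ?(lt_le_trans e0) // mul1r.
    apply: le_lt_trans (hs x) _; apply: lt_le_trans eN.
    by rewrite ltr_pdivrMr // ltr_pMr // ltr1n.
  exists [set x | vabs (step_fun s x - 1) < 1].
    exact: (step_fun_level ringG GT (fun y => vabs (y - 1) < 1)).
  move=> x /s1; rewrite indicE /=; have [xA|xA] := pselect (A x).
    by rewrite mem_set.
  (* A value at distance below 1 from both 0 and 1 would give [vabs 1 < 1]. *)
  rewrite memNset // subr0 => sx; split=> // sx1.
  have := vabs_addlt sx (etrans (congr1 (fun z => z < 1) (vabs_distC _ _)) sx1).
  by rewrite addrC subrK vabs1 ltxx.
apply/na_integrableP => e e0; have [B GB AB] := h e e0.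
exists [:: (1, B)] => [p|x]; first by rewrite inE => /eqP ->.
rewrite /step_fun big_cons big_nil addr0 mul1r vabs_distC.
exact: vabs_indicB.
Qed.

(** Two late approximants differ by a step function of small norm, written as one list with the
    second half negated; so the integrals form a Cauchy sequence and [K] is complete. *)
Lemma has_integral_exists f : na_integrable G mu f ->
  exists v, has_integral G mu f v.
Proof.
move=> [s sf]; have sG := proj1 sf.
have [|v hv] := @vabs_complete _ K (fun n => step_integral mu (s n)).
  move=> e e0; have e20 : 0 < e / 2 by rewrite divr_gt0.
  have [n0 _ hn0] := step_approx_near sf e20.
  exists n0 => m n n0m n0n.
  have small x : vabs (step_fun (s m) x - step_fun (s n) x) * N x <= e / 2.
    rewrite -(subrKA (f x)).
    apply: vabs_add_point_norm; first exact: hn0.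
    by rewrite vabs_distC; exact: hn0.
  pose t := s m ++ [seq (- p.1, p.2) | p <- s n].
  have tfun x : step_fun t x = step_fun (s m) x - step_fun (s n) x.
    rewrite /step_fun big_cat big_map /= -sumrN.
    by under [X in _ + X = _]eq_bigr do rewrite mulNr.
  have tint : step_integral mu t = step_integral mu (s m) - step_integral mu (s n).
    rewrite /step_integral big_cat big_map /= -sumrN.
    by under [X in _ + X = _]eq_bigr do rewrite mulNr.
  rewrite -tint; apply: (@le_lt_trans _ _ (e / 2)).
    apply: vabs_step_integral_le; [|exact: ltW|by move=> x; rewrite tfun].
    move=> p; rewrite mem_cat => /orP[/sG //|/mapP[q /sG Gq ->] //].
  by rewrite ltr_pdivrMr // ltr_pMr // ltr1n.
by exists v, s.
Qed.

(** Both values are compared with the integral of a late step function approximating the indicator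
    of [A]. This computes the extended measure up to [e] from [mu] on [G]. *)
Lemma measure_ext_approx A B e : ring_ext G mu A -> G B -> 0 < e ->
  level_eq e A B -> vabs (measure_ext G mu A - mu B) <= e.
Proof.
move=> /has_integral_exists[v0 hv0] GB e0 AB.
(* The existing integral [v0] excludes the default value of [xget]. *)
rewrite /measure_ext /na_integral; case: xgetP => [v _ [s sA sv]|/(_ v0)//].
have [n1 _ hn1] := step_approx_near sA e0.
have /cvgr0Pnorm_le/(_ e e0)[n2 _ hn2] := sv.
set n := maxn n1 n2.
have {hn1}s1 := hn1 n (leq_maxl _ _); have {hn2} /= := hn2 n (leq_maxr _ _).
rewrite ger0_norm ?vabs_ge0 // => s2.
rewrite -(subrKA (step_integral mu (s n))); apply: vabs_addle.
  by rewrite vabs_distC.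
have tint : step_integral mu ((-1, B) :: s n) = step_integral mu (s n) - mu B.
  by rewrite /step_integral big_cons mulN1r addrC.
rewrite -tint; apply: vabs_step_integral_le; [|exact: ltW|].
  by move=> p; rewrite inE => /predU1P[->//|]; exact: (proj1 sA).
move=> x; rewrite /step_fun big_cons mulN1r addrC -(subrKA (\1_A x)).
by apply: vabs_add_point_norm; [exact: s1|exact: vabs_indicB].
Qed.

Lemma ring_ext_covering : covering_ring (ring_ext G mu).
Proof.
(* An operation defined pointwise on membership respects agreement on level sets; this yields all
   three closure properties. *)
have op (f : Prop -> Prop -> Prop) (F : set X -> set X -> set X) :
    (forall A B x, F A B x = f (A x) (B x)) ->
    (forall A B, G A -> G B -> G (F A B)) ->
    forall A B, ring_ext G mu A -> ring_ext G mu B -> ring_ext G mu (F A B).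
  move=> Ff FG A B /ring_extP hA /ring_extP hB; apply/ring_extP => e e0.
  have [A' GA' AA'] := hA e e0; have [B' GB' BB'] := hB e e0.
  exists (F A' B'); first exact: FG.
  by move=> x eN; rewrite !Ff (propext (AA' x eN)) (propext (BB' x eN)).
split.
- apply/seteqP; split=> // x _; exists setT => //.
  by apply/ring_extP => e _; exists setT.
- exact: (op and).
- exact: (op or).
- exact: (op (fun P Q => P /\ ~ Q)).
Qed.

(** * Clopen sets of the extended topology *)

Lemma ring_ext_open A : ring_ext G mu A ->
  open (A : set (ring_space (ring_ext G mu))).
Proof.
move=> hA; apply/(ring_space_open _ ring_ext_covering) => x Ax.
by exists A => //; split=> // y.
Qed.

Lemma ring_extC A : ring_ext G mu A -> ring_ext G mu (~` A).
Proof.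
apply: (algebraC ring_ext_covering).
by apply/ring_extP => e _; exists setT.
Qed.

(* Two open sets of the extended topology that partition X are, on the compact
   level set {N >= e}, separated by finitely many members of G. *)
Lemma clopen_ring_ext A :
  open (A : set (ring_space (ring_ext G mu))) ->
  open (~` A : set (ring_space (ring_ext G mu))) -> ring_ext G mu A.
Proof.
move=> /(ring_space_open _ ring_ext_covering) oA.
move=> /(ring_space_open _ ring_ext_covering) oCA.
apply/ring_extP => e e0.
(* [C] approximates [B] from inside, but only on the level set. *)
pose inner B C := G C /\ forall x, e <= N x -> C x -> B x.
have inner_pt B x : (exists2 C, ring_ext G mu C & C x /\ C `<=` B) -> e <= N x ->
    exists2 C, inner B C & C x.
  move=> [C /ring_extP/(_ e e0)[D GD' CD] [Cx CB]] eN.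
  exists D; last exact/(CD x eN).
  by split=> // y /CD CDy /CDy/CB.
have innerU B C D : inner B C -> inner B D -> inner B (C `|` D).
  move=> [GC' CB] [GD' DB]; split; first exact: GU.
  by move=> x eN [/CB|/DB]; apply.
have inner0 B : inner B set0 by [].
pose F := [set U | exists C D, [/\ inner A C, inner (~` A) D & U = C `|` D]].
have [|||x _ eN|U [C [D [[GC' CA] [GD' DA] ->]]] small] :=
    @cover_set_norm setT F e GT _ _ _ e0.
- by move=> _ [C [D [[GC' _] [GD' _] ->]]]; exact: GU.
- by exists (set0 `|` set0), set0, set0.
- move=> _ _ [C [D [iC iD ->]]] [C' [D' [iC' iD' ->]]].
  exists (C `|` C'), (D `|` D').
  by split; [exact: innerU|exact: innerU|rewrite setUACA].
- have [xA|xA] := pselect (A x).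
    have [C iC Cx] := inner_pt _ _ (oA x xA) eN.
    by exists (C `|` set0); [exists C, set0|left].
  have [D iD Dx] := inner_pt _ _ (oCA x xA) eN.
  by exists (set0 `|` D); [exists set0, D|right].
exists C => // x eN; split=> [xA|]; last exact: CA.
(* A point of [A] with [N x >= e] is not in [D]; outside [C] it would lie in the complement of the
   cover, whose norm is below [e]. *)
apply: contrapT => nCx; suff : N x < e by rewrite ltNge eN.
apply: le_lt_trans small; apply: point_norm_le; first by apply/GD/GU.
split=> // -[//|Dx]; apply: (DA x) => //.
Qed.

(** * Invariance of the extended ring, the point norm and integrability *)

(** Members of [ring_ext] are clopen since their complements are members too, and continuity
    preserves clopen sets. *)
Lemma clopen_preimage (T : X -> X) A :
  continuous (T : ring_space (ring_ext G mu) -> ring_space (ring_ext G mu)) ->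
  ring_ext G mu A -> ring_ext G mu (T @^-1` A).
Proof.
move=> /continuousP cT hA; apply: clopen_ring_ext.
  exact/cT/ring_ext_open.
exact: (cT _ (ring_ext_open (ring_extC hA))).
Qed.

(* If V is a neighbourhood of T x in G with norm V < N x, then inside T^-1 V
   there is a set C of measure larger than norm V; its image under T is
   S^-1 C, contained in V. *)
Lemma point_norm_preserving_le (S T : X -> X) : cancel S T ->
  (forall A, ring_ext G mu A -> ring_ext G mu (T @^-1` A)) ->
  (forall A, ring_ext G mu A -> ring_ext G mu (S @^-1` A)) ->
  (forall A, ring_ext G mu A ->
     measure_ext G mu (S @^-1` A) = measure_ext G mu A) ->
  forall x, N x <= N (T x).
Proof.
move=> SK hT hS Smu x; rewrite leNgt; apply/negP => /point_norm_lt[V [GV VTx Vx]].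
(* The midpoint [d] of [norm V] and [N x] is a level that [x] exceeds and no point of [V]
   reaches. *)
have [Vd dx] := midf_lt Vx; set d := (_ / 2) in Vd dx.
have d0 : 0 < d by apply: le_lt_trans Vd; exact: set_norm_ge0.
have hW : ring_ext G mu (T @^-1` V).
  by apply: hT; apply/ring_extP => e _; exists V.
have [B GB WB] := proj1 (ring_extP _) hW d d0.
have [D [GD' DB Dd]] : exists D, [/\ G D, D `<=` B & d < vabs (mu D)].
  apply: contrapT => nD.
  have : norm B < N x.
    apply: le_lt_trans dx; apply: set_norm_le => // D GD' DB.
    by rewrite leNgt; apply/negP => dD; apply: nD; exists D.
  by rewrite ltNge point_norm_le //; apply/WB => //; exact: ltW.
pose C := D `&` T @^-1` V.
have hC : ring_ext G mu C.
  apply: (covering_ringI ring_ext_covering) => //.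
  by apply/ring_extP => e _; exists D.
have CD : level_eq d C D.
  by move=> y dy; split=> [[]//|Dy]; split=> //; apply/(WB y dy)/DB.
have SC0 : level_eq d (S @^-1` C) set0.
  move=> y dy; split=> // -[_ /=]; rewrite SK => Vy.
  by have := le_lt_trans (le_trans dy (point_norm_le GV Vy)) Vd; rewrite ltxx.
have := measure_ext_approx (hS _ hC) G0 d0 SC0.
rewrite na_measure0 subr0 Smu // => Cd.
have := vabs_suble Cd (measure_ext_approx hC GD' d0 CD).
by rewrite opprB addrC subrK leNgt Dd.
Qed.

(** Composition with [T] turns a step function over [G] into a combination of indicators of sets in
    [ring_ext], still integrable; the invariance of [N] carries the error bound over. *)
Lemma na_integrable_comp (T : X -> X) f :
  (forall A, ring_ext G mu A -> ring_ext G mu (T @^-1` A)) ->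
  (forall x, N (T x) = N x) ->
  na_integrable G mu f -> na_integrable G mu (f \o T).
Proof.
move=> hT NT /na_integrableP hf; apply/na_integrableP => e e0.
have [s sG hs] := hf e e0.
have : na_integrable G mu (step_fun s \o T).
  elim: s sG {hs} => [_|[c A] s ih sG].
    apply/na_integrableP => r r0; exists [::] => // x.
    by rewrite /step_fun /= !big_nil subrr vabs0 mul0r ltW.
  rewrite (_ : _ \o T = fun x => c * \1_(T @^-1` A) x + (step_fun s \o T) x).
    apply: na_integrableD; last by apply: ih => p ps; apply: sG; rewrite inE ps orbT.
    apply/na_integrableZ/hT/ring_extP => r _; exists A => //.
    by apply: (sG (c, A)); rewrite inE eqxx.
  by apply/funext => x; rewrite /step_fun /= big_cons !indicE.
move=> /na_integrableP/(_ e e0)[t tG ht]; exists t => // x.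
rewrite -(subrKA ((step_fun s \o T) x)); apply: vabs_add_point_norm => //.
by rewrite -(NT x); exact: hs.
Qed.

End measure.

(** * The composition operator on classes *)

Theorem lemma3p4 (R : realType) (K : completeNAField R) (X : Type)
    (G : set (set X)) (mu : set X -> K) (T : X -> X) :
  covering_ring G -> separating G -> na_probability G mu ->
  invertible_measure_preserving G mu T ->
  exists2 U : L1 G mu -> L1 G mu, composition_operator T U
    & forall phi : L1 G mu, L1_norm (U phi) = L1_norm phi.
Proof.
move=> ringG _ muP [[cT Tmu] [_ [S [TK SK cS]]] Tmu'].
have hT A := clopen_preimage ringG muP cT (A := A).
have hS A := clopen_preimage ringG muP cS (A := A).
(* Preimages under the inverse [S] are images under [T]. *)
have Smu A : ring_ext G mu A ->
    measure_ext G mu (S @^-1` A) = measure_ext G mu A.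
  move=> /Tmu' <-; congr measure_ext.
  by apply/seteqP; split=> [x Ax|_ [x Ax <-]] /=; [exists (S x)|rewrite TK].
(* One inequality comes from [T] at [x], the other from [S] at [T x]. *)
have NT x : point_norm G mu (T x) = point_norm G mu x.
  apply/eqP; rewrite eq_le (point_norm_preserving_le ringG muP SK hT hS Smu) andbT.
  by have := point_norm_preserving_le ringG muP TK hS hT Tmu (T x); rewrite TK.
have fT (f : Defs.Lfun G mu) : `[< na_integrable G mu (f \o T) >].
  apply/asboolP/(na_integrable_comp ringG muP hT NT).
  exact/asboolP/(valP f).
pose comp (f : Defs.Lfun G mu) : Defs.Lfun G mu := exist _ (Lfun_fun f \o T) (fT f).
(* Another representative changes the composite only at points that [T] sends to null points; these
   are null themselves because [N] is invariant. *)
exists (fun phi => L1_class (comp (repr phi))) => [f|phi].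
  exists (comp f) => //; apply/eqmodP/asboolP => x /= neq.
  have /eqmodP/asboolP h : \pi_(L1 G mu)%qT (repr (L1_class f)) = \pi_(L1 G mu)%qT f.
    by rewrite reprK.
  by rewrite /null_points /= -NT; exact: h.
(* Since [T] is a bijection preserving [N], it merely reindexes the supremum. *)
rewrite L1_norm_class /L1_norm /fun_norm; congr ereal_sup.
apply/seteqP; split=> _ [x _ <-] /=.
  by exists (T x) => //; rewrite NT.
by exists (S x) => //; rewrite -(NT (S x)) /Lfun_fun /= SK.
Qed.
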